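(* Let $\mathbb{T}$ be a time scale, let $a,b\in\mathbb{T}$ with $a<b$, and let $I\subset\mathbb{R}$ be an interval. Let $x,y,p,g:[a,b]_{\mathbb{T}}\to I$ be rd-continuous functions on $[a,b]_{\mathbb{T}}$, with $g$ non-decreasing on $[a,b]_{\mathbb{T}}$ and $p$ bounded and nonnegative on $[a,b]_{\mathbb{T}}$. Let $F:I\to\mathbb{R}$ be a non-decreasing, continuous and convex function on $I$. Suppose that $y$ and $x-y$ are both non-decreasing on $[a,b]_{\mathbb{T}}$ or both non-increasing on $[a,b]_{\mathbb{T}}$, and that $$\int_a^b p(t)y(t)\,\Delta g(t)\leq\int_a^b p(t)x(t)\,\Delta g(t).$$ Then $$\int_a^b p(t)F(y(t))\,\Delta g(t)\leq \int_a^b p(t)F(x(t))\,\Delta g(t).$$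
   Context: A time scale $\mathbb{T}$ is a nonempty closed subset of $\mathbb{R}$, and $[a,b]_{\mathbb{T}}:=[a,b]\cap\mathbb{T}$, $[a,b)_{\mathbb{T}}:=[a,b)\cap\mathbb{T}$. A function on a time scale is rd-continuous if it is continuous at every right-dense point and has finite left-sided limits at every left-dense point. Riemann--Stieltjes $\Delta$-integral: let $f,g$ be bounded real-valued functions on $[a,b]_{\mathbb{T}}$ with $g$ non-decreasing on $[a,b]_{\mathbb{T}}$. A partition of $[a,b]_{\mathbb{T}}$ is a finite set $P=\{t_0,\dots,t_n\}\subset[a,b]_{\mathbb{T}}$ with $a=t_0<t_1<\dots<t_n=b$; a partition $P\supset P^*$ is called a refinement of $P^*$. For a selection $X=\{x_1,\dots,x_n\}$ with $x_i\in[t_{i-1},t_i)_{\mathbb{T}}$ put $S_g(f,P,X)=\sum_{i=1}^n f(x_i)(g(t_i)-g(t_{i-1}))$. Then $f$ is Riemann--Stieltjes $\Delta$-integrable with respect to $g$ on $[a,b]_{\mathbb{T}}$ if there is a number $\mathcal{I}\in\mathbb{R}$ such that for every $\varepsilon>0$ there is a partition $P^*$ with $|S_g(f,P,X)-\mathcal{I}|<\varepsilon$ for all refinements $P\supset P^*$ and all selections $X$ for $P$; this (unique) number is denoted $\int_a^b f(t)\,\Delta g(t)=\mathcal{I}$. *)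

(* Defs.v *)
From mathcomp Require Export all_boot all_order all_algebra.
From mathcomp Require Export all_classical all_reals all_analysis.
Export Order.TTheory GRing.Theory Num.Theory.
Export numFieldNormedType.Exports.

Set Implicit Arguments.
Unset Strict Implicit.
Unset Printing Implicit Defensive.

Local Open Scope classical_set_scope.
Local Open Scope ring_scope.

Definition time_scale (R : realType) (T : set R) : Prop :=
  T !=set0 /\ closed T.

Definition ts_itv (R : realType) (T : set R) (a b : R) : set R :=
  `[a, b] `&` T.

(* The conventions inf set0 = sup T and sup set0 = inf T for the jump
   operators are not implemented: the two density predicates below use them
   only where the set in question is nonempty. *)
Definition forward_jump (R : realType) (T : set R) (t : R) : R :=
  inf (T `&` `]t, +oo[).

Definition backward_jump (R : realType) (T : set R) (t : R) : R :=
  sup (T `&` `]-oo, t[).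

(* A maximal point of T is not right-dense and a minimal point of T is not
   left-dense. *)
Definition right_dense (R : realType) (T : set R) (t : R) : Prop :=
  [/\ T t, T `&` `]t, +oo[ !=set0 & forward_jump T t = t].

Definition left_dense (R : realType) (T : set R) (t : R) : Prop :=
  [/\ T t, T `&` `]-oo, t[ !=set0 & backward_jump T t = t].

(* Only the values of f on T matter. *)
Definition rd_continuous (R : realType) (T : set R) (f : R -> R) : Prop :=
  (forall t : R, right_dense T t -> f @ within T (nbhs t) --> f t) /\
  (forall t : R, left_dense T t ->
     exists l : R, f @ within (T `&` `]-oo, t[) (nbhs t) --> l).

(* As in itv_partition, the partition {t_0 < ... < t_n} with t_0 = a is
   represented by s = [:: t_1; ...; t_n]. *)
Definition ts_partition (R : realType) (T : set R) (a b : R) (s : seq R) :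
    Prop :=
  itv_partition a b s /\ (forall t, t \in s -> T t).

(* X i is the point selected in [t_i, t_(i+1))_T. *)
Definition ts_selection (R : realType) (T : set R) (a : R) (s : seq R)
    (X : nat -> R) : Prop :=
  forall i : nat, (i < size s)%N ->
    T (X i) /\ nth a (a :: s) i <= X i < nth a (a :: s) i.+1.

Definition rs_sum (R : realType) (g f : R -> R) (a : R) (s : seq R)
    (X : nat -> R) : R :=
  \sum_(0 <= i < size s)
    f (X i) * (g (nth a (a :: s) i.+1) - g (nth a (a :: s) i)).

Definition is_rs_integral (R : realType) (T : set R) (g : R -> R) (a b : R)
    (f : R -> R) (l : R) : Prop :=
  [/\ [bounded f t | t in ts_itv T a b],
      [bounded g t | t in ts_itv T a b],
      {in ts_itv T a b &, {homo g : s t / s <= t}} &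
      forall e : R, 0 < e ->
        exists2 s0 : seq R, ts_partition T a b s0 &
          forall (s : seq R) (X : nat -> R),
            ts_partition T a b s -> {subset s0 <= s} ->
            ts_selection T a s X ->
            `|rs_sum g f a s X - l| < e].

Definition rs_integrable (R : realType) (T : set R) (g : R -> R) (a b : R)
    (f : R -> R) : Prop :=
  exists l : R, is_rs_integral T g a b f l.

(* Equal to 0 when f is not integrable with respect to g. *)
Definition rs_integral (R : realType) (T : set R) (g : R -> R) (a b : R)
    (f : R -> R) : R :=
  xget 0 [set l | is_rs_integral T g a b f l].

(* Main.v *)
Require Import Defs.
From mathcomp Require Import ring lra.

Set Implicit Arguments.
Unset Strict Implicit.

Local Open Scope classical_set_scope.
Local Open Scope ring_scope.

(** The inequality comes from a pointwise one. Where [x t <> y t], let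
    [S t] be the slope of the chord of [F] between [x t] and [y t]. Since [y] and
    [x - y] are monotone in the same direction, a point [t] with [x t < y t] and
    a point [s] with [y s < x s] always satisfy [x t < y t <= y s < x s], so
    [S t <= S s] by convexity. If some [s] with [y s < x s] exists, the infimum
    [k] of the slopes at such points therefore separates the two families,
    [k >= 0] because [F] is non-decreasing, and
    [F (x t) - F (y t) >= k * (x t - y t)] for every [t].

    If [x <= y] everywhere, no such [k] need exist: the chords may become
    vertical at the right end of [I], as for [- sqrt (1 - u)] on [[0, 1]]. But
    for every [e > 0] there is some [k >= 0] with
    [F (x t) - F (y t) >= k * (x t - y t) - e], because among the increments of
    [F] of a given length the rightmost one is the largest, and [F] is
    continuous at the maximum of [y]. The lemma [convex_support_crossing] treats
    both cases. Multiplying by [p >= 0] and integrating gives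
    [int p F(x) - int p F(y) >= k * (int p x - int p y) - e * int p >= - e * int p],
    and [e] is arbitrary.

    The integrals have to exist. Being monotone, [x] and [y] stay within compact
    subintervals of [I], which contain their left limits too; hence [F \o x] and
    [F \o y] are rd-continuous and bounded ([rd_continuous_comp]). An
    rd-continuous function is, up to any [e > 0], a step function on [[a, b[]
    with jumps at points of [T] ([rd_continuous_step]). The sums of such a step
    function no longer change once the partition contains its jumps, so the sums
    of the function itself satisfy the Cauchy criterion
    ([rd_continuous_rs_cvg]).

    All statements on integrals are limits along one filter, [rs_filter], so that
    uniqueness, linearity and monotonicity are those of limits. *)

(** * Bounds for monotone functions *)

Lemma bounded_between (R : realType) (D : set R) (f : R -> R) (m M : R) :
  (forall t, D t -> m <= f t <= M) -> [bounded f t | t in D].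
Proof.
move=> fmM; exists (Num.max (- m) M); split; first exact: num_real.
move=> N; rewrite gt_max => /andP[mN MN] t /fmM /andP[mf fM].
by rewrite /= ler_norml; apply/andP; split; lra.
Qed.

Lemma monotone_between (R : realType) (D : set R) (f : R -> R) (a b : R) :
  D a -> D b -> (forall t, D t -> a <= t <= b) ->
  {in D &, {homo f : s t / s <= t}} \/ {in D &, {homo f : s t /~ s <= t}} ->
  forall t, D t -> Num.min (f a) (f b) <= f t <= Num.max (f a) (f b).
Proof.
move=> Da Db Dab f_mono t Dt; have /andP[at_ tb] := Dab t Dt.
rewrite ge_min le_max; case: f_mono => f_mono.
  by rewrite [f a <= _]f_mono ?[_ <= f b]f_mono ?inE ?orbT.
by rewrite [f b <= _]f_mono ?[_ <= f a]f_mono ?inE ?orbT.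
Qed.

Lemma bounded_mul (R : realType) (D : set R) (f h : R -> R) :
  [bounded f t | t in D] -> [bounded h t | t in D] ->
  [bounded f t * h t | t in D].
Proof.
move=> /ex_strict_bound_gt0[M M0 fM] /ex_strict_bound_gt0[N N0 hN].
apply: (@bounded_between _ _ _ (- (M * N)) (M * N)) => t Dt.
rewrite -ler_norml normrM; apply: ler_pM => //; apply: ltW.
  exact: fM.
exact: hN.
Qed.

(** * Partitions *)

Lemma ts_partition_nth (R : realType) (T : set R) (a b : R) (s : seq R) i :
  T a -> ts_partition T a b s -> (i <= size s)%N ->
  ts_itv T a b (nth a (a :: s) i).
Proof.
move=> Ta [abs sT] si; split; last first.
  by case: i si => //= i si; apply/sT/mem_nth.
have -> : nth a (a :: s) i = nth b (a :: s) i by apply: set_nth_default.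
by rewrite /= in_itv/= itv_partition_nth_ge ?itv_partition_nth_le.
Qed.

Lemma ts_partition_mem (R : realType) (T : set R) (a b : R) (s : seq R) t :
  T a -> ts_partition T a b s -> t \in a :: s -> ts_itv T a b t.
Proof.
move=> Ta abs /(nthP a)[i si <-]; exact: ts_partition_nth.
Qed.

Lemma ts_partition_nth_size (R : realType) (T : set R) (a b : R) (s : seq R) :
  ts_partition T a b s -> nth a (a :: s) (size s) = b.
Proof. by move=> [[_ /eqP <-] _]; rewrite -[size s]/((size (a :: s)).-1) nth_last. Qed.

Lemma ts_partition_merge (R : realType) (T : set R) (a b : R) (s1 s2 : seq R) :
  T a -> a < b -> ts_partition T a b s1 -> ts_partition T a b s2 ->
  exists2 s, ts_partition T a b s & {subset s1 <= s} /\ {subset s2 <= s}.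
Proof.
move=> Ta ab p1 p2.
pose s := sort <=%O (undup (s1 ++ s2)).
have ms t : (t \in s) = (t \in s1) || (t \in s2).
  by rewrite mem_sort mem_undup mem_cat.
have as_gt (s' : seq R) : ts_partition T a b s' -> all (> a) s'.
  by move=> [[/(order_path_min lt_trans)]].
have pas : path <%O a s.
  rewrite path_sortedE; last exact: lt_trans.
  rewrite sort_lt_sorted undup_uniq andbT.
  apply/allP => t; rewrite ms => /orP[] ts; last exact: (allP (as_gt _ p2)).
  exact: (allP (as_gt _ p1)).
have bs : b \in s.
  have := ts_partition_nth_size p1; rewrite ms.
  case: (s1) => [/= ba|c s' <-]; first by rewrite ba ltxx in ab.
  by apply/orP; left; apply: (@mem_nth _ a (c :: s') (size s')); exact: ltnSn.
exists s; last by split=> t ts; rewrite ms ts ?orbT.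
split=> [|t]; last first.
  by rewrite ms => /orP[]; [exact: p1.2|exact: p2.2].
split=> //; apply/eqP/le_anti/andP; split.
  have : last a s \in s.
    by case: (s) bs => // c s' _; rewrite /= mem_last.
  rewrite ms => /orP[] ts.
    have := ts_partition_mem (t := last a s) Ta p1.
    by rewrite inE ts orbT => /(_ isT)[]; rewrite /= in_itv/= => /andP[].
  have := ts_partition_mem (t := last a s) Ta p2.
  by rewrite inE ts orbT => /(_ isT)[]; rewrite /= in_itv/= => /andP[].
have ib : (index b (a :: s) < size (a :: s))%N by rewrite index_mem inE bs orbT.
have -> : last a s = nth a (a :: s) (size s)
  by rewrite -[RHS]/(nth a (a :: s) (size (a :: s)).-1) nth_last.
rewrite -{1}(nth_index a (_ : b \in a :: s)); last by rewrite inE bs orbT.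
by rewrite (lt_sorted_leq_nth a (s := a :: s)) ?inE.
Qed.

(** * Riemann-Stieltjes sums *)

Lemma rs_sum_linear (R : realType) (g f1 f2 : R -> R) (c a : R) s X :
  rs_sum g (fun t => c * f1 t + f2 t) a s X =
  c * rs_sum g f1 a s X + rs_sum g f2 a s X.
Proof.
rewrite /rs_sum mulr_sumr -big_split/=; apply: eq_bigr => i _.
by rewrite mulrDl mulrA.
Qed.

Lemma rs_sum_const (R : realType) (T : set R) (g : R -> R) (a b c : R) s X :
  ts_partition T a b s -> rs_sum g (fun=> c) a s X = c * (g b - g a).
Proof.
move=> abs; rewrite /rs_sum -mulr_sumr.
by rewrite (telescope_sumr (fun i => g (nth a (a :: s) i)))// (ts_partition_nth_size abs).
Qed.

Lemma ler_rs_sum (R : realType) (T : set R) (g f1 f2 : R -> R) (a b : R) s X :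
  T a -> {in ts_itv T a b &, {homo g : u v / u <= v}} ->
  ts_partition T a b s -> ts_selection T a s X ->
  (forall t, ts_itv T a b t -> t < b -> f1 t <= f2 t) ->
  rs_sum g f1 a s X <= rs_sum g f2 a s X.
Proof.
move=> Ta gnd abs sX f12.
rewrite /rs_sum !big_nat; apply: ler_sum => i /= si.
have [TX /andP[tX Xt]] := sX _ si.
have ti := ts_partition_nth Ta abs (ltnW si).
have ti1 := ts_partition_nth Ta abs si.
have [ai bi] : a <= nth a (a :: s) i /\ nth a (a :: s) i.+1 <= b.
  move: ti.1 ti1.1; rewrite /= !in_itv/=.
  by move=> /andP[? _] /andP[_ ?].
apply: ler_wpM2r.
  rewrite subr_ge0 gnd ?inE//; exact/ltW/(le_lt_trans tX Xt).
apply: f12; last exact: lt_le_trans bi.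
by split=> //; rewrite /= in_itv/= (le_trans ai)//= (le_trans (ltW Xt)).
Qed.

(** If [v] is a point of the partition, no cell straddles it: a cell lies either
    below [v], where the tag is below [v] too, or above. Each term is then the
    increment of [g] truncated at [v], and the sum telescopes. *)
Lemma rs_sum_indic (R : realType) (T : set R) (g : R -> R) (a b v : R) s X :
  T a -> ts_partition T a b s -> ts_selection T a s X -> v \in a :: s ->
  rs_sum g (fun r => (r < v)%R%:R) a s X = g v - g a.
Proof.
move=> Ta abs sX vs.
have /andP[av vb] : a <= v <= b by have [] := ts_partition_mem Ta abs vs; rewrite /= in_itv.
have lt_s : sorted <%R (a :: s) by case: abs => -[].
have [k ks kv] := nthP a vs.
rewrite /rs_sum.
transitivity (\sum_(0 <= i < size s)
    (g (Num.min (nth a (a :: s) i.+1) v) - g (Num.min (nth a (a :: s) i) v))).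
  rewrite big_nat [RHS]big_nat; apply: eq_bigr => i /= si.
  have [_ /andP[tX Xt]] := sX _ si.
  have [Xv|vX] := ltP (X i) v.
    have ik : (i < k)%N.
      rewrite -(lt_sorted_ltn_nth a lt_s) ?inE//= ?ltnS 1?ltnW//.
      by rewrite kv (le_lt_trans tX).
    have tv : nth a (a :: s) i.+1 <= v.
      by rewrite -kv (lt_sorted_leq_nth a lt_s) ?inE//= ?ltnS.
    rewrite mul1r (min_idPl tv) (min_idPl _)//.
    exact: le_trans (ltW (le_lt_trans tX Xt)) _.
  have ki : (k <= i)%N.
    rewrite -ltnS -(lt_sorted_ltn_nth a lt_s) ?inE//=.
    by rewrite kv (le_lt_trans vX).
  have vt : v <= nth a (a :: s) i.
    by rewrite -kv (lt_sorted_leq_nth a lt_s) ?inE//= ?ltnS// ltnW.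
  rewrite mul0r (min_idPr vt) (min_idPr _) ?subrr//.
  exact: le_trans vt (ltW (le_lt_trans tX Xt)).
rewrite (telescope_sumr (fun i => g (Num.min (nth a (a :: s) i) v)))//.
by rewrite (ts_partition_nth_size abs) (min_idPr vb)/= (min_idPl av).
Qed.

(** * The integral as a limit *)

(** The sets of tagged partitions [(s, X)] whose points include those of a given
    partition form a filter base, since two partitions have a common refinement. *)
Definition rs_filter (R : realType) (T : set R) (a b : R) :
    set_system (seq R * (nat -> R)) :=
  filter_from (ts_partition T a b) (fun s0 => [set sX |
    [/\ ts_partition T a b sX.1, {subset s0 <= sX.1}
      & ts_selection T a sX.1 sX.2]]).

Lemma rs_filter_proper (R : realType) (T : set R) (a b : R) :
  T a -> T b -> a < b -> ProperFilter (rs_filter T a b).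
Proof.
move=> Ta Tb ab; apply: filter_from_proper; last first.
  move=> s abs; exists (s, fun i => nth a (a :: s) i); split=> //= i si.
  split; first by case: (ts_partition_nth Ta abs (ltnW si)).
  by rewrite lexx/=; case: abs => -[/(pathP a)] + _ _; apply.
apply: filter_from_filter.
  exists [:: b]; split; first exact: itv_partition1.
  by move=> t; rewrite inE => /eqP ->.
move=> s1 s2 p1 p2.
have [s ps [s1s s2s]] := ts_partition_merge Ta ab p1 p2.
exists s => // -[s' X] /= [ps' ss' sX].
by split; split=> //= t ts; apply: ss'; [exact: s1s|exact: s2s].
Qed.

Lemma rs_filter_refines (R : realType) (T : set R) (a b : R) (v : R) :
  T b -> a < b -> ts_itv T a b v ->
  \forall sX \near rs_filter T a b, v \in a :: sX.1.
Proof.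
move=> Tb ab [/=]; rewrite in_itv/= => /andP[av vb] Tv.
move: av; rewrite le_eqVlt => /orP[/eqP <-|av].
  exists [:: b]; last by move=> sX _; rewrite /= mem_head.
  split; first exact: itv_partition1.
  by move=> t; rewrite inE => /eqP ->.
move: vb; rewrite le_eqVlt => /orP[/eqP ->|vb].
  exists [:: b]; last by move=> sX [_ bs _]; rewrite /= inE bs ?orbT// mem_head.
  split; first exact: itv_partition1.
  by move=> t; rewrite inE => /eqP ->.
exists [:: v; b].
  split; first by rewrite /itv_partition/= av vb.
  by move=> t; rewrite !inE => /orP[] /eqP ->.
by move=> sX [_ vbs _]; rewrite inE vbs ?orbT// mem_head.
Qed.

Lemma near_rs_filter (R : realType) (T : set R) (a b : R) :
  T b -> a < b -> \forall sX \near rs_filter T a b,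
  ts_partition T a b sX.1 /\ ts_selection T a sX.1 sX.2.
Proof.
move=> Tb ab; exists [:: b]; last by move=> sX [].
split; first exact: itv_partition1.
by move=> t; rewrite inE => /eqP ->.
Qed.

(** The definition by refinements is convergence along [rs_filter]; the
    boundedness of [g] that it also asks for comes from monotonicity. *)
Lemma is_rs_integralP (R : realType) (T : set R) (g : R -> R) (a b : R) f l :
  T a -> T b -> a < b ->
  [bounded f t | t in ts_itv T a b] ->
  {in ts_itv T a b &, {homo g : s t / s <= t}} ->
  is_rs_integral T g a b f l <->
  rs_sum g f a sX.1 sX.2 @[sX --> rs_filter T a b] --> l.
Proof.
move=> Ta Tb ab bf gnd.
have FF := rs_filter_proper Ta Tb ab.
split=> [[_ _ _ fl]|/cvgrPdist_lt fl].
  apply/cvgrPdist_lt => e /fl[s0 p0 fs0]; exists s0 => // -[s X] /= [ps s0s sX].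
  by rewrite distrC; exact: fs0.
split => //.
  apply: bounded_between (monotone_between (a := a) (b := b) _ _ _ (or_introl gnd)).
  - by split=> //=; rewrite in_itv/= lexx ltW.
  - by split=> //=; rewrite in_itv/= lexx ltW.
  - by move=> t [/=]; rewrite in_itv.
move=> e e0; have [s0 p0 fs0] := fl e e0; exists s0 => // s X ps s0s sX.
by rewrite distrC; exact: (fs0 (s, X)).
Qed.

(** * Integrability of rd-continuous functions *)

Lemma closure_inf (R : realType) (A : set R) : has_inf A -> closure A (inf A).
Proof.
move=> hA B /nbhs_ballP[e /= e0 eB].
have [t At ts] := inf_adherent e0 hA.
exists t; split=> //; apply: eB; rewrite /ball/= distrC ger0_norm.
  by rewrite ltrBlDl.
by rewrite subr_ge0; apply: ge_inf => //; exact: hA.2.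
Qed.

Lemma cvg_within_dist (R : realType) (D : set R) (f : R -> R) (c l e : R) :
  f @ within D (nbhs c) --> l -> 0 < e ->
  exists2 d, 0 < d & forall r, D r -> `|c - r| < d -> `|f r - l| < e.
Proof.
move=> /cvgrPdist_lt fl /fl /nbhs_ballP[d /= d0 dP]; exists d => // r Dr cr.
by rewrite distrC; apply: dP.
Qed.

(** A connectedness argument: let [c] be the supremum of the [t] such that a step
    function vanishing from [t] on is [e]-close to [f] before [t]. The left limit
    of [f] at [c] shows that [c] itself is such a [t]. If [c < b], one can go
    further: by continuity when [c] is right-dense, and otherwise up to the next
    point of the time scale, since the cell between them contains [c] only. *)
Lemma rd_continuous_step (R : realType) (T : set R) (g f : R -> R) (a b e : R) :
  closed T -> T a -> T b -> a < b -> rd_continuous (ts_itv T a b) f -> 0 < e ->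
  exists (phi : R -> R) (l : R),
    (rs_sum g phi a sX.1 sX.2 @[sX --> rs_filter T a b] --> l) /\
    forall t, ts_itv T a b t -> t < b -> `|f t - phi t| <= e.
Proof.
move=> clT Ta Tb ab [f_rd f_ld] e0.
have FF := rs_filter_proper Ta Tb ab.
set D := ts_itv T a b.
have clD : closed D by apply: closedI => //; exact: interval_closed.
have Dle t : D t -> a <= t <= b by move=> [/=]; rewrite in_itv.
have Da : D a by split=> //=; rewrite in_itv/= lexx ltW.
have Db : D b by split=> //=; rewrite in_itv/= lexx ltW.
pose P t := D t /\ exists (phi : R -> R) (l : R), [/\
    rs_sum g phi a sX.1 sX.2 @[sX --> rs_filter T a b] --> l,
    forall r, D r -> r < t -> `|f r - phi r| <= e &
    forall r, t <= r -> phi r = 0].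
have Pa : P a.
  split=> //; exists (fun=> 0), 0; split=> //.
    apply: cvg_near_cst; near=> sX; apply: big1 => i _; exact: mul0r.
  by move=> r /Dle /andP[+ _] /lt_geF => ->.
have Pext t t' c : P t -> t < t' -> D t' ->
    (forall r, D r -> t <= r -> r < t' -> `|f r - c| <= e) -> P t'.
  move=> [Dt [phi [l [phil fphi phi0]]]] tt' Dt' fc; split=> //.
  (* Differences of indicators of the form [r < v] add the value [c] on [[t, t'[]. *)
  exists (fun r => c * ((r < t')%R%:R - (r < t)%R%:R) + phi r).
  exists (c * (g t' - g t) + l); split.
  - have -> : (fun sX => rs_sum g (fun r => c * ((r < t')%R%:R - (r < t)%R%:R) + phi r) a sX.1 sX.2)
      = (fun sX => c * (- 1 * rs_sum g (fun r => (r < t)%R%:R) a sX.1 sX.2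
                  + rs_sum g (fun r => (r < t')%R%:R) a sX.1 sX.2) + rs_sum g phi a sX.1 sX.2).
      apply/funext => sX; rewrite -!rs_sum_linear.
      by congr (rs_sum _ _ _ _ _); apply/funext => r; rewrite mulN1r (addrC (- _)).
    apply: cvgD => //; apply: cvg_near_cst.
    have := near_rs_filter Tb ab; have := rs_filter_refines Tb ab Dt.
    have := rs_filter_refines Tb ab Dt'.
    apply: filterS3 => sX t's ts [ps sX'].
    rewrite (rs_sum_indic _ Ta ps sX' ts) (rs_sum_indic _ Ta ps sX' t's).
    by rewrite mulN1r opprB addrC subrKA.
  - move=> r Dr rt'; rewrite rt'; have [rt|tr] := ltP r t.
      by rewrite subrr mulr0 add0r fphi.
    by rewrite phi0// subr0 mulr1 addr0 fc.
  - move=> r t'r; rewrite phi0 ?(le_trans (ltW tt'))// addr0.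
    by rewrite !ltNge t'r (le_trans (ltW tt') t'r) subrr mulr0.
have Psup : has_sup [set t | P t].
  by split; [exists a|exists b => t [/Dle /andP[]]].
set c := sup [set t | P t].
have Pc_ub t : P t -> t <= c by move=> Pt; apply: ub_le_sup => //; exact: Psup.2.
have Dc : D c.
  by apply/clD; apply: closure_subset (closure_sup Psup.1 Psup.2) => t [].
have Pc : P c.
  apply: contrapT => nPc.
  have cadh d : 0 < d -> exists t, [/\ P t, c - d < t & t < c].
    move=> d0; have [t Pt ts] := sup_adherent d0 Psup; exists t; split=> //.
    rewrite lt_neqAle Pc_ub// andbT; apply/eqP => tc.
    by apply: nPc; rewrite -tc.
  have c_ld : left_dense D c.
    have hs : has_sup (D `&` `]-oo, c[).
      split; last by exists c => t [_ /=]; rewrite in_itv/= => /ltW.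
      have [t [Pt _ tc]] := cadh _ ltr01.
      by exists t; split=> /=; [exact: Pt.1|rewrite in_itv].
    split=> //; first exact: hs.1.
    apply/le_anti/andP; split.
      by apply: ge_sup; [exact: hs.1|move=> t [_ /=]; rewrite in_itv/= => /ltW].
    rewrite leNgt; apply/negP => sc.
    have [|t [Pt + tc]] := cadh (c - backward_jump D c); first by rewrite subr_gt0.
    rewrite subKr ltNge => /negP; apply; apply: ub_le_sup; first exact: hs.2.
    by split=> /=; [exact: Pt.1|rewrite in_itv].
  have [l /cvg_within_dist/(_ e0)[d d0 dP]] := f_ld _ c_ld.
  have [t [Pt ct tc]] := cadh _ d0.
  apply: nPc; apply: (Pext t c l) => // r Dr tr rc.
  apply/ltW/dP; first by split=> //=; rewrite in_itv.
  rewrite gtr0_norm ?subr_gt0//.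
  by rewrite ltrBlDr -ltrBlDl (lt_le_trans ct).
suff cb : c = b.
  have [_ [phi [l [phil fphi _]]]] := Pc; exists phi, l.
  by split=> // t Dt tb; apply: fphi => //; rewrite cb.
apply/eqP; rewrite eq_le; have /andP[_ ->] /= := Dle _ Dc.
rewrite leNgt; apply/negP => cb.
have hi : has_inf (D `&` `]c, +oo[).
  split; first by exists b; split=> //=; rewrite in_itv/= andbT.
  by exists c => t [_ /=]; rewrite in_itv/= andbT => /ltW.
have c_inf : c <= forward_jump D c.
  by apply: lb_le_inf; [exact: hi.1|move=> t [_ /=]; rewrite in_itv/= andbT => /ltW].
have cbad t' k : c < t' -> D t' ->
    (forall r, D r -> c <= r -> r < t' -> `|f r - k| <= e) -> False.
  by move=> ct' Dt' /(Pext _ _ _ Pc ct' Dt')/Pc_ub; rewrite leNgt ct'.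
have [infc|] := eqVneq (forward_jump D c) c.
  have c_rd : right_dense D c by split=> //; exact: hi.1.
  have [d d0 dP] := cvg_within_dist (f_rd _ c_rd) e0.
  have [t' [Dt' /=]] := inf_adherent d0 hi.
  rewrite in_itv/= andbT => ct'; rewrite -/(forward_jump D c) infc => t'd.
  apply: (cbad t' (f c)) => // r Dr cr rt'; apply/ltW/dP => //.
  rewrite distrC ger0_norm ?subr_ge0//.
  by rewrite ltrBlDl (lt_trans rt').
rewrite neq_lt ltNge c_inf/= => cs.
have Ds : D (forward_jump D c).
  by apply/clD; apply: closure_subset (closure_inf hi) => t [].
apply: (cbad _ (f c) cs Ds) => r Dr; rewrite le_eqVlt => /orP[/eqP <- _|cr rs].
  by rewrite subrr normr0 ltW.
exfalso; move: rs; rewrite ltNge => /negP; apply; apply: ge_inf; first exact: hi.2.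
by split=> //=; rewrite in_itv/= cr.
Unshelve. all: by end_near.
Qed.

Lemma rs_sum_dist (R : realType) (T : set R) (g f h : R -> R) (a b e : R) s X :
  T a -> {in ts_itv T a b &, {homo g : u v / u <= v}} ->
  ts_partition T a b s -> ts_selection T a s X ->
  (forall t, ts_itv T a b t -> t < b -> `|f t - h t| <= e) ->
  `|rs_sum g f a s X - rs_sum g h a s X| <= e * (g b - g a).
Proof.
move=> Ta gnd ps sX fh.
have rs_shift u v : (forall t, ts_itv T a b t -> t < b -> u t <= 1 * v t + e) ->
    rs_sum g u a s X - rs_sum g v a s X <= e * (g b - g a).
  move=> /(ler_rs_sum Ta gnd ps sX); rewrite rs_sum_linear mul1r.
  by rewrite (rs_sum_const _ _ _ ps) lerBlDl.
rewrite ler_norml lerNl opprB; apply/andP; split; apply: rs_shift => t Dt tb.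
  have := fh t Dt tb; rewrite ler_norml => /andP[+ _]; lra.
have := fh t Dt tb; rewrite ler_norml => /andP[_]; lra.
Qed.

Lemma rd_continuous_rs_cvg (R : realType) (T : set R) (g f : R -> R) (a b : R) :
  closed T -> T a -> T b -> a < b ->
  {in ts_itv T a b &, {homo g : u v / u <= v}} ->
  rd_continuous (ts_itv T a b) f ->
  cvg (rs_sum g f a sX.1 sX.2 @[sX --> rs_filter T a b]).
Proof.
move=> clT Ta Tb ab gnd f_rd.
have FF := rs_filter_proper Ta Tb ab.
have gab : g a <= g b.
  by apply: gnd (ltW ab); rewrite inE; split=> //=; rewrite in_itv/= lexx ltW.
apply: cauchy_cvg; apply: cauchy_exP => e e0.
(* The [+ 1] keeps the denominator positive when [g] is constant. *)
pose d := e / 2 / (g b - g a + 1).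
have d0 : 0 < d by rewrite !divr_gt0//; lra.
have [phi [l [phil fphi]]] := rd_continuous_step g clT Ta Tb ab f_rd d0.
exists l; rewrite /= nbhs_filterE.
have /cvgrPdist_lt/(_ (e / 2)) := phil; rewrite divr_gt0// => /(_ isT).
have := near_rs_filter Tb ab.
apply: filterS2 => -[s X]/= [ps sX] phie.
have := rs_sum_dist Ta gnd ps sX fphi.
have : d * (g b - g a) <= e / 2.
  rewrite /d mulrAC ler_pdivrMr ?ler_wpM2l//; lra.
move=> h1 h2; rewrite /ball/=.
have := ler_distD (rs_sum g phi a s X) l (rs_sum g f a s X).
rewrite (distrC (rs_sum g phi a s X)); lra.
Qed.

Lemma rd_continuousM (R : realType) (D : set R) (f h : R -> R) :
  rd_continuous D f -> rd_continuous D h -> rd_continuous D (fun t => f t * h t).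
Proof.
move=> [fr fl] [hr hl]; split=> t Dt; first exact: cvgM (fr _ Dt) (hr _ Dt).
have [l fl'] := fl _ Dt; have [k hk] := hl _ Dt.
by exists (l * k); exact: cvgM fl' hk.
Qed.

(** Closedness of [K] puts the left limits of [u] in [K], where [F] is
    continuous. This fails for an open [K], where [F \o u] may blow up. *)
Lemma rd_continuous_comp (R : realType) (D K : set R) (u F : R -> R) :
  closed K -> (forall t, D t -> K (u t)) -> {within K, continuous F} ->
  rd_continuous D u -> rd_continuous D (fun t => F (u t)).
Proof.
move=> clK uK /subspace_continuousP Fc [ur ul].
have Fu (A : set R) (t l : R) : A `<=` D -> K l -> u @ within A (nbhs t) --> l ->
    F (u r) @[r --> within A (nbhs t)] --> F l.
  move=> AD Kl ul'; apply: cvg_comp (Fc _ Kl) => B /= Bl.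
  have := ul' _ Bl; rewrite /= !nbhs_filterE /within/=.
  by apply: filterS => r uB /[dup] Ar /uB; apply; exact/uK/AD.
split=> t tD.
  by case: (tD) => Dt _ _; apply: Fu => //; [exact: uK|exact: ur].
have [l ul'] := ul _ tD; exists (F l); case: (tD) => Dt Dlt tsup.
apply: (Fu _ _ _ _ _ ul'); first by move=> r [].
have FF : ProperFilter (within (D `&` `]-oo, t[) (nbhs t)).
  apply: within_nbhs_proper; rewrite -{2}tsup; apply: closure_sup => //.
  by exists t => r [_ /=]; rewrite in_itv/= => /ltW.
apply: (closed_cvg _ clK _ _ ul').
by apply: filterS (withinT _ _) => r [/uK].
Qed.

Lemma rd_continuous_rs_integral (R : realType) (T : set R) (g f : R -> R) (a b : R) :
  closed T -> T a -> T b -> a < b ->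
  {in ts_itv T a b &, {homo g : u v / u <= v}} ->
  rd_continuous (ts_itv T a b) f -> [bounded f t | t in ts_itv T a b] ->
  rs_integrable T g a b f /\
  (rs_sum g f a sX.1 sX.2 @[sX --> rs_filter T a b] --> rs_integral T g a b f).
Proof.
move=> clT Ta Tb ab gnd f_rd bf.
have int_lim := @is_rs_integralP _ _ g _ _ f _ Ta Tb ab bf gnd.
have /cvg_ex[l /int_lim fl] := rd_continuous_rs_cvg clT Ta Tb ab gnd f_rd.
split; first by exists l.
by apply/int_lim; apply: (xgetI (P := [set l | is_rs_integral T g a b f l]) 0 fl).
Qed.

(** * Convexity *)

Lemma convex_itv_chord (R : realType) (I : interval R) (F : R -> R) u v w :
  convex_function [set` I] F -> u \in I -> w \in I -> u <= v <= w ->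
  F v * (w - u) <= F u * (w - v) + F w * (v - u).
Proof.
move=> cF uI wI /andP[uv vw].
have [uw|wu] := ltP u w; last first.
  have -> : v = u by lra.
  have -> : w = u by lra.
  by rewrite !subrr !mulr0 addr0.
have wu0 : 0 < w - u by rewrite subr_gt0.
pose t := (w - v) / (w - u).
have t0 : 0 <= t by rewrite divr_ge0 ?subr_ge0// ltW.
have t1 : t <= 1 by rewrite ler_pdivrMr// mul1r; lra.
have := cF (Itv01 t0 t1) u w; rewrite !inE => /(_ uI wI).
rewrite /conv/= /GRing.scale/= => cv.
have -> : F u * (w - v) + F w * (v - u) = (t * F u + (1 - t) * F w) * (w - u).
  by rewrite /t; field; rewrite gt_eqF.
apply: ler_wpM2r; first exact: ltW.
have -> : v = t * u + (1 - t) * w by rewrite /t; field; rewrite gt_eqF.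
exact: cv.
Qed.

(** Both chords are compared with the chord from [u] to [q]. The intervals
    [[u, v]] and [[p, q]] may overlap, so this also compares the increments of [F]
    over two intervals of equal length. *)
Lemma convex_slope_le (R : realType) (I : interval R) (F : R -> R) u v p q :
  convex_function [set` I] F -> u \in I -> q \in I ->
  u < v -> p < q -> u <= p -> v <= q ->
  (F v - F u) * (q - p) <= (F q - F p) * (v - u).
Proof.
move=> cF uI qI uv pq up vq.
have /(convex_itv_chord cF uI qI) Fv : u <= v <= q by rewrite (ltW uv).
have /(convex_itv_chord cF uI qI) Fp : u <= p <= q by rewrite (ltW pq) andbT.
have uq : 0 < q - u by lra.
rewrite -(ler_pM2r uq).
have h1 : (F v - F u) * (q - u) * (q - p) <= (F q - F u) * (v - u) * (q - p).
  by apply: ler_wpM2r; lra.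
have h2 : (F q - F u) * (q - p) * (v - u) <= (F q - F p) * (q - u) * (v - u).
  by apply: ler_wpM2r; lra.
lra.
Qed.

(** The intervals from [x t] to [y t] with [x t < y t] lie to the left of those
    from [y s] to [x s] with [y s < x s], and slopes of chords increase to the
    right; [k] separates the slopes of the two families. The error [e] is there for the case where the
    second one is empty, as the slopes of the first may then be unbounded. *)
Lemma convex_support_crossing (R : realType) (I : interval R) (F : R -> R)
    (D : set R) (x y : R -> R) (m M e : R) :
  convex_function [set` I] F -> {in I &, {homo F : u v / u <= v}} ->
  {within [set` I], continuous F} -> m \in I -> M \in I ->
  (forall t, D t -> x t \in I /\ m <= x t) ->
  (forall t, D t -> y t \in I /\ y t <= M) ->
  (forall s t, D s -> D t -> x t < y t -> y s < x s -> y t <= y s) ->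
  0 < e ->
  exists2 k, 0 <= k &
    forall t, D t -> k * (x t - y t) - e <= F (x t) - F (y t).
Proof.
move=> cF ndF contF mI MI xI yI cross e0.
have [[s [Ds yxs]]|nex] := pselect (exists s, D s /\ y s < x s).
  pose E := [set (F (x s) - F (y s)) / (x s - y s) | s in [set s | D s /\ y s < x s]].
  have E0 z : E z -> 0 <= z.
    move=> [r [Dr yxr] <-]; rewrite divr_ge0 ?subr_ge0 ?(ltW yxr)//.
    by apply: ndF; [exact: (yI _ Dr).1|exact: (xI _ Dr).1|exact: ltW].
  have hE : has_inf E.
    by split; [exists ((F (x s) - F (y s)) / (x s - y s)), s|exists 0 => z /E0].
  exists (inf E); first by apply: lb_le_inf; [exact: hE.1|move=> z /E0].
  move=> t Dt; have [xyt|xyt|->] := ltgtP (x t) (y t).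
  - suff : (F (y t) - F (x t)) / (y t - x t) <= inf E.
      rewrite ler_pdivrMr ?subr_gt0//; lra.
    apply: lb_le_inf; first exact: hE.1.
    move=> _ [r [Dr yxr] <-].
    rewrite ler_pdivrMr ?subr_gt0// mulrAC ler_pdivlMr ?subr_gt0//.
    have ytr := cross r t Dr Dt xyt yxr.
    apply: (convex_slope_le cF) => //; first exact: (xI _ Dt).1.
    + exact: (xI _ Dr).1.
    + exact/ltW/(lt_le_trans xyt).
    + exact/(le_trans ytr)/ltW.
  - have : inf E <= (F (x t) - F (y t)) / (x t - y t).
      by apply: ge_inf; [exact: hE.2|exists t].
    rewrite ler_pdivlMr ?subr_gt0//; lra.
  - by rewrite !subrr mulr0 sub0r oppr_le0 ltW.
have xy t : D t -> x t <= y t.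
  by move=> Dt; rewrite leNgt; apply/negP => yx; apply: nex; exists t.
move/subspace_continuousP : contF => /(_ _ MI)/cvgrPdist_lt/(_ _ e0).
move=> /nbhs_ballP[d /= d0 dP].
exists (`|F M - F m| / d); first by rewrite divr_ge0// ltW.
move=> t Dt; have [xIt mx] := xI _ Dt; have [yIt yM] := yI _ Dt.
have Fxy : F (x t) <= F (y t) by apply: ndF => //; exact: xy.
(* [d] is a modulus of continuity of [F] at [M]. Pairs at distance at least [d]
   have slopes bounded by [k]; for closer ones, the increment of [F] is moved
   right until it ends at [M]. *)
have [yxd|dyx] := ltP (y t - x t) d; last first.
  suff : F (y t) - F (x t) <= `|F M - F m| / d * (y t - x t) by lra.
  apply: (@le_trans _ _ `|F M - F m|); last first.
    by rewrite -mulrA ler_peMr// mulrC ler_pdivlMr// mul1r.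
  apply: le_trans (ler_norm _); apply: lerB; apply: ndF => //.
have k0 : 0 <= `|F M - F m| / d * (y t - x t).
  by rewrite mulr_ge0 ?divr_ge0 ?subr_ge0 ?xy// ltW.
suff : F (y t) - F (x t) <= e by lra.
have := xy _ Dt; rewrite le_eqVlt => /orP[/eqP ->|xyt]; first by rewrite subrr ltW.
have qI : M - (y t - x t) \in I.
  by apply: (interval_is_interval xIt MI); apply/andP; split; lra.
have : `|F M - F (M - (y t - x t))| < e.
  by apply: dP => //; rewrite /ball/= subKr gtr0_norm// subr_gt0.
move=> /(le_lt_trans (ler_norm _))/ltW; apply: le_trans.
have := @convex_slope_le R I F (x t) (y t) (M - (y t - x t)) M cF xIt MI xyt.
rewrite subKr ler_pM2r ?subr_gt0//; apply; lra.
Qed.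

(** * The inequality *)

Theorem theorem21 (R : realType) (T : set R) (a b : R) (I : interval R)
    (x y p g F : R -> R)
    (hT : time_scale T) (ha : T a) (hb : T b) (hab : a < b)
    (xI : forall t, ts_itv T a b t -> x t \in I)
    (yI : forall t, ts_itv T a b t -> y t \in I)
    (pI : forall t, ts_itv T a b t -> p t \in I)
    (gI : forall t, ts_itv T a b t -> g t \in I)
    (x_rd : rd_continuous (ts_itv T a b) x)
    (y_rd : rd_continuous (ts_itv T a b) y)
    (p_rd : rd_continuous (ts_itv T a b) p)
    (g_rd : rd_continuous (ts_itv T a b) g)
    (g_nd : {in ts_itv T a b &, {homo g : s t / s <= t}})
    (p_bounded : [bounded p t | t in ts_itv T a b])
    (p_ge0 : forall t, ts_itv T a b t -> 0 <= p t)
    (F_nd : {in I &, {homo F : u v / u <= v}})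
    (F_cont : {within [set` I], continuous F})
    (F_convex : convex_function [set` I] F)
    (mono :
       ({in ts_itv T a b &, {homo y : s t / s <= t}} /\
        {in ts_itv T a b &, {homo (x \- y) : s t / s <= t}}) \/
       ({in ts_itv T a b &, {homo y : s t /~ s <= t}} /\
        {in ts_itv T a b &, {homo (x \- y) : s t /~ s <= t}}))
    (h_int : rs_integral T g a b (fun t => p t * y t) <=
             rs_integral T g a b (fun t => p t * x t)) :
  [/\ rs_integrable T g a b (fun t => p t * F (y t)),
      rs_integrable T g a b (fun t => p t * F (x t)) &
      rs_integral T g a b (fun t => p t * F (y t)) <=
      rs_integral T g a b (fun t => p t * F (x t))].
Proof.
have [_ clT] := hT.
have Dle t : ts_itv T a b t -> a <= t <= b by move=> [/=]; rewrite in_itv.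
have Da : ts_itv T a b a by split=> //=; rewrite in_itv/= lexx ltW.
have Db : ts_itv T a b b by split=> //=; rewrite in_itv/= lexx ltW.
have y_mono : {in ts_itv T a b &, {homo y : s t / s <= t}} \/
    {in ts_itv T a b &, {homo y : s t /~ s <= t}}.
  by case: mono => -[]; [left|right].
have x_mono : {in ts_itv T a b &, {homo x : s t / s <= t}} \/
    {in ts_itv T a b &, {homo x : s t /~ s <= t}}.
  case: mono => -[ym xym]; [left|right] => s t Ds Dt st.
    by have := ym s t Ds Dt st; have /= := xym s t Ds Dt st; lra.
  by have := ym s t Ds Dt st; have /= := xym s t Ds Dt st; lra.
have cross s t : ts_itv T a b s -> ts_itv T a b t ->
    x t < y t -> y s < x s -> y t <= y s.
  move=> /mem_set Ds /mem_set Dt xyt yxs.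
  case: mono => -[ym xym]; have [st|ts] := leP s t.
  - by have /= := xym s t Ds Dt st; lra.
  - exact/ym/ltW.
  - exact: ym.
  - by have /= := xym s t Ds Dt (ltW ts); lra.
have range_I f : (forall t, ts_itv T a b t -> f t \in I) ->
    Num.min (f a) (f b) \in I /\ Num.max (f a) (f b) \in I.
  by move=> fI; rewrite minEle maxEle; case: ifP => _; rewrite !fI.
have weighted u : (forall t, ts_itv T a b t -> u t \in I) ->
    rd_continuous (ts_itv T a b) u ->
    {in ts_itv T a b &, {homo u : s t / s <= t}} \/
    {in ts_itv T a b &, {homo u : s t /~ s <= t}} ->
    [/\ rs_integrable T g a b (fun t => p t * F (u t)),
        rs_sum g (fun t => p t * F (u t)) a sX.1 sX.2 @[sX --> rs_filter T a b] -->
          rs_integral T g a b (fun t => p t * F (u t)) &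
        rs_sum g (fun t => p t * u t) a sX.1 sX.2 @[sX --> rs_filter T a b] -->
          rs_integral T g a b (fun t => p t * u t)].
  move=> uI u_rd u_mono.
  have u_btw := monotone_between Da Db Dle u_mono.
  have [mI MI] := range_I u uI.
  have Fu_rd : rd_continuous (ts_itv T a b) (fun t => F (u t)).
    apply: (@rd_continuous_comp _ _ `[Num.min (u a) (u b), Num.max (u a) (u b)]) => //.
    - exact: interval_closed.
    - apply: continuous_subspaceW F_cont => r /=; rewrite in_itv/=.
      exact: (interval_is_interval mI MI).
  have [|? ?] := rd_continuous_rs_integral clT ha hb hab g_nd (rd_continuousM p_rd Fu_rd).
    apply: bounded_mul => //.
    apply: (@bounded_between _ _ _ (F (Num.min (u a) (u b))) (F (Num.max (u a) (u b)))).
    by move=> t Dt; have /andP[? ?] := u_btw t Dt; rewrite !F_nd ?uI.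
  have [|? ?] := rd_continuous_rs_integral clT ha hb hab g_nd (rd_continuousM p_rd u_rd).
    exact: bounded_mul p_bounded (bounded_between u_btw).
  by [].
have [intFx limFx limx] := weighted x xI x_rd x_mono.
have [intFy limFy limy] := weighted y yI y_rd y_mono.
have [_ limp] := rd_continuous_rs_integral clT ha hb hab g_nd p_rd p_bounded.
split=> //.
have FF := rs_filter_proper ha hb hab.
have ge0_lim f l : (forall t, ts_itv T a b t -> 0 <= f t) ->
    rs_sum g f a sX.1 sX.2 @[sX --> rs_filter T a b] --> l -> 0 <= l.
  move=> f0 /cvgr_to_ge; apply.
  apply: filterS (near_rs_filter hb hab) => sX [ps sX'].
  apply: le_trans (ler_rs_sum (f1 := fun=> 0) ha g_nd ps sX' (fun t Dt _ => f0 t Dt)).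
  by rewrite (rs_sum_const _ _ _ ps) mul0r.
have p0 := ge0_lim _ _ p_ge0 limp.
apply/ler_addgt0Pr => e e0.
(* The [+ 1] keeps the denominator positive when [p] has integral 0. *)
pose d := e / (rs_integral T g a b p + 1).
have d0 : 0 < d by rewrite divr_gt0//; lra.
have de : d * rs_integral T g a b p <= e.
  rewrite /d mulrAC ler_pdivrMr ?ler_pM2l//; lra.
have [k k0 kP] : exists2 k, 0 <= k & forall t, ts_itv T a b t ->
    k * (x t - y t) - d <= F (x t) - F (y t).
  apply: (convex_support_crossing (I := I) (m := Num.min (x a) (x b))
    (M := Num.max (y a) (y b))) => //.
  - exact: (range_I x xI).1.
  - exact: (range_I y yI).2.
  - by move=> t Dt; have /andP[] := monotone_between Da Db Dle x_mono Dt; split=> //; exact: xI.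
  - by move=> t Dt; have /andP[] := monotone_between Da Db Dle y_mono Dt; split=> //; exact: yI.
pose A u := rs_integral T g a b (fun t => p t * u t).
have : 0 <= d * rs_integral T g a b p + (k * A y + (- k * A x
    + (- 1 * A (F \o y) + A (F \o x)))).
  apply: (ge0_lim (fun t => d * p t + (k * (p t * y t) + (- k * (p t * x t)
    + (- 1 * (p t * F (y t)) + p t * F (x t)))))).
    move=> t Dt; have := mulr_ge0 (p_ge0 t Dt) (_ : 0 <= F (x t) - F (y t) - k * (x t - y t) + d).
    have := kP t Dt; lra.
  under eq_fun do rewrite !rs_sum_linear.
  do 4![apply: cvgD; first by apply: cvgMr].
  exact: limFx.
have : k * A y <= k * A x by apply: ler_wpM2l.
rewrite /A/=; lra.
Qed.
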